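(* Let $p$ be a prime with $p\equiv 3\pmod 4$ and $p>3$, and let $S(p)$ be the $\frac{p-1}{2}\times\frac{p-1}{2}$ matrix $$S(p)=\left(\left(\frac{j^2+k^2}{p}\right)\right)_{1\le j,k\le (p-1)/2},$$ where $\left(\frac{\cdot}{p}\right)$ is the Legendre symbol. Then $$\nu_2(\det[S(p)])\ge\frac{p-3}{2}.$$
   Context: Here $\nu_2(x)$ denotes the $2$-adic order of $x$. *)

(* Defs.v *)
From mathcomp Require Import all_boot all_order all_algebra.
From mathcomp Require Import constructive_ereal.

Set Implicit Arguments.
Unset Strict Implicit.
Unset Printing Implicit Defensive.

Import Order.TTheory GRing.Theory Num.Theory.
Local Open Scope ring_scope.

(* Legendre symbol (a / p), meant for p an odd prime. *)
Definition legendre (p : nat) (a : int) : int :=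
  if (p%:Z %| a)%Z then 0
  else if [exists x : 'I_p, (x%:Z ^+ 2 == a %[mod p%:Z])%Z] then 1
  else -1.

(* p-adic order with the convention nu_p(0) = +oo; logn alone would give
   logn p 0 = 0. *)
Definition padic_order (p : nat) (x : int) : \bar int :=
  if x == 0 then +oo%E else ((logn p `|x|%N)%:Z)%:E.

(* Indices 1 <= j, k <= (p-1)/2 are i.+1 for i : 'I_((p-1)/2). *)
Definition S_mx (p : nat) : 'M[int]_((p - 1) %/ 2) :=
  \matrix_(j, k) legendre p (j.+1 ^ 2 + k.+1 ^ 2)%N%:Z.

(* Main.v *)
Require Import Defs.
From mathcomp Require Import all_boot all_order all_algebra.
From mathcomp Require Import constructive_ereal.
From mathcomp Require Import finfield zify.
Import Order.TTheory GRing.Theory Num.Theory.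
Local Open Scope ring_scope.

(** Since [p] is 3 modulo 4, -1 is not a square modulo [p]
    ([sum_two_squares_ndvd]), so no [j^2 + k^2] with [j] and [k] prime to [p]
    vanishes modulo [p]: every entry of the matrix is 1 or -1, hence odd. In an
    odd matrix of order [n + 1] all rows agree modulo 2, so subtracting the
    first row from the [n] others makes these divisible by 2 without changing
    the determinant, which is therefore divisible by [2 ^ n]
    ([dvdz_det_congruent_rows]). Here [n + 1 = (p - 1) / 2], that is
    [n = (p - 3) / 2]. *)

(** Clearing the first row from the others and dividing them by [d] amounts to
    factoring [A = M *m C], with [C] integral and [M] lower triangular of
    diagonal [1, d, .., d]. *)
Lemma dvdz_det_congruent_rows (n : nat) (d : int) (A : 'M[int]_n.+1) :
  (forall i j, (d %| A i j - A ord0 j)%Z) -> (d ^+ n %| \det A)%Z.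
Proof.
move=> rowsA.
pose M : 'M[int]_n.+1 := \matrix_(i, j)
  if j == ord0 then 1 else d *+ (i == j).
pose C : 'M[int]_n.+1 := \matrix_(i, j)
  if i == ord0 then A ord0 j else ((A i j - A ord0 j) %/ d)%Z.
have detM : \det M = d ^+ n.
  rewrite det_trig; last first.
    apply/is_trig_mxP => i j lt_ij; rewrite mxE.
    case: eqP lt_ij => [-> // | _ lt_ij].
    by case: eqP lt_ij => [-> | //]; rewrite ltnn.
  rewrite big_ord_recl mxE eqxx mul1r.
  under eq_bigr => i _ do rewrite mxE eqxx mulr1n.
  by rewrite prodr_const card_ord.
have -> : A = M *m C.
  apply/matrixP => i j; rewrite !mxE big_ord_recl !mxE eqxx mul1r.
  case: (unliftP ord0 i) => [i' ->|->]; last first.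
    by rewrite big1 ?addr0 // => k _; rewrite !mxE mul0r.
  rewrite (bigD1 i') //= big1 ?addr0 => [|k ne_ki].
    rewrite !mxE eqxx mulr1n /= mulrC divzK //.
    by rewrite addrC subrK.
  by rewrite !mxE /= (inj_eq lift_inj) eq_sym (negPf ne_ki) mul0r.
by rewrite det_mulmx detM dvdz_mulr.
Qed.

(** With [(p - 1) / 2] odd, raising [a^2 = - b^2] to that power in ['F_p] gives
    [1 = -1] by Fermat's little theorem. *)
Lemma sum_two_squares_ndvd (p a b : nat) :
  prime p -> p = 3 %[mod 4] -> ~~ (p %| a)%N -> ~~ (p %| b)%N ->
  ~~ (p %| a ^ 2 + b ^ 2)%N.
Proof.
move=> p_pr p_mod4.
have p_char : p \in [pchar 'F_p] by exact: pchar_Fp.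
have fermat (x : 'F_p) : x != 0 -> x ^+ p.-1 = 1.
  move=> nz_x; apply: (mulfI nz_x); rewrite -exprS mulr1.
  by rewrite prednK ?prime_gt0 //; have := expf_card x; rewrite card_Fp.
rewrite !(dvdn_pcharf p_char) => nz_a nz_b.
rewrite natrD !natrX addr_eq0; apply/eqP => /(congr1 (fun x => x ^+ (p.-1)./2)).
have [odd_h def_p] : odd (p.-1)./2 /\ (2 * (p.-1)./2)%N = p.-1 by lia.
rewrite exprNn -!exprM def_p !fermat // -signr_odd odd_h expr1 mulr1.
move/eqP; rewrite -subr_eq0 opprK -(natrD _ 1 1) -(dvdn_pcharf p_char).
by move/dvdn_leq => /(_ isT); lia.
Qed.

Theorem corollary1 (p : nat) (p_prime : prime p) (p_mod4 : p = 3 %[mod 4])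
    (p_gt3 : (3 < p)%N) :
  ((((p - 3) %/ 2)%N%:Z)%:E <= padic_order 2 (\det (S_mx p)))%E.
Proof.
have oddS j k : (2 %| S_mx p j k - 1)%Z.
  rewrite mxE /legendre ifF; first by case: ifP.
  have ndvd (i : 'I_((p - 1) %/ 2)) : ~~ (p %| i.+1)%N.
    by rewrite gtnNdvd //; have := ltn_ord i; lia.
  apply/negbTE; rewrite /dvdz /=.
  exact: sum_two_squares_ndvd.
move: (S_mx p) oddS.
have -> : ((p - 1) %/ 2 = ((p - 3) %/ 2).+1)%N by lia.
move=> A oddA.
have dvd_det : (2 ^+ ((p - 3) %/ 2) %| \det A)%Z.
  apply: dvdz_det_congruent_rows => i j.
  by have := rpredB (oddA i j) (oddA ord0 j); rewrite opprB addrA subrK.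
rewrite /padic_order; case: eqP => [_ | /eqP nz_det]; first by rewrite leey.
by move: dvd_det; rewrite dvdzE abszX pfactor_dvdn ?absz_gt0.
Qed.
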